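(* Let $(u_n)_{n\geq 0}$ be a non-degenerate Lucas sequence, $u_n=a_1u_{n-1}+a_2u_{n-2}$, with non-zero discriminant $\Delta_u=a_1^2+4a_2$, and let $g_u(n)=\gcd(n,u_n)$. Then $$\#\{ n\leq x : g_u(n)>y\}\leq \frac{x^{2}}{y\exp\left((1+o_{u}(1))\sqrt{(\log x)(\log \log x)}\right)},$$ for every $y\geq 1$, when $x$ is sufficiently large.
   Context: A Lucas sequence is a sequence of integers $(u_n)_{n\geq 0}$ with $u_0=0$, $u_1=1$ and $u_n=a_1u_{n-1}+a_2u_{n-2}$ for all $n\geq 2$, where $a_1,a_2\in\mathbb{Z}$ and $a_2\neq 0$. It is non-degenerate if no ratio $\alpha_i/\alpha_j$ ($i\neq j$) of pairwise distinct complex roots of the characteristic polynomial $X^2-a_1X-a_2$ is a root of unity. The set counted consists of positive integers $n\leq x$. The symbol $o_u(1)$ denotes a function of $x$ tending to $0$ as $x\to\infty$, where the function may depend on the sequence $u$. *)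

(* Defs.v *)
From HB Require Import structures.
From mathcomp Require Import all_boot all_order all_algebra.
From mathcomp Require Import complex.
From mathcomp Require Import finmap.
From mathcomp Require Import all_classical all_reals all_analysis.
Set Implicit Arguments.
Unset Strict Implicit.
Unset Printing Implicit Defensive.
Import Order.TTheory GRing.Theory Num.Theory numFieldNormedType.Exports.
Local Open Scope classical_set_scope.
Local Open Scope ring_scope.

Definition is_lucas (a1 a2 : int) (u : nat -> int) : Prop :=
  [/\ a2 != 0, u 0%N = 0, u 1%N = 1
    & forall n : nat, (2 <= n)%N -> u n = a1 * u n.-1 + a2 * u n.-2].

Definition lucas_charpoly (a1 a2 : int) : {poly int} :=
  'X^2 - a1 *: 'X - a2%:P.

Definition lucas_disc (a1 a2 : int) : int := a1 ^+ 2 + 4 * a2.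

Definition lucas_nondegenerate (R : realType) (a1 a2 : int) : Prop :=
  forall alpha beta : complex R,
    root (map_poly intr (lucas_charpoly a1 a2)) alpha ->
    root (map_poly intr (lucas_charpoly a1 a2)) beta ->
    alpha != beta ->
    ~ exists2 k : nat, (0 < k)%N & k.-unity_root (alpha / beta).

Definition lucas_gcd (u : nat -> int) (n : nat) : int := gcdz n%:Z (u n).

Definition large_gcd_set (R : realType) (u : nat -> int) (x y : R) : set nat :=
  [set n : nat | [/\ (0 < n)%N, n%:R <= x & y < (lucas_gcd u n)%:~R]].

(* fset_set is the empty set on infinite arguments, so the cardinal below is
   the intended one only because of this fact. *)
Lemma finite_large_gcd_set (R : realType) (u : nat -> int) (x y : R) :
  finite_set (large_gcd_set u x y).
Proof.
apply: (@sub_finite_set _ _ `I_(Num.truncn x).+1); last exact: finite_II.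
move=> n [_ nx _] /=; rewrite ltnS.
have x0 : 0 <= x by apply: le_trans nx.
by rewrite truncn_ge_nat.
Qed.

Definition large_gcd_count (R : realType) (u : nat -> int) (x y : R) : nat :=
  #|` fset_set (large_gcd_set u x y)|%fset.

(* Main.v *)
Require Import Defs.
From HB Require Import structures.
From mathcomp Require Import all_boot all_order all_algebra.
From mathcomp Require Import complex.
From mathcomp Require Import finmap.
From mathcomp Require Import all_classical all_reals all_analysis.
From mathcomp Require Import closed_field.
From mathcomp Require Import zify ring lra.
Set Implicit Arguments.
Unset Strict Implicit.
Unset Printing Implicit Defensive.
Import Order.TTheory GRing.Theory Num.Theory numFieldNormedType.Exports.
Local Open Scope classical_set_scope.
Local Open Scope ring_scope.

(** Write g(n) = gcd(n, u_n), l = ln x, w = ln l and L = sqrt(l w). Since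
y times the number of n <= x with g(n) > y is at most the sum S(x) of g(n)
over n <= x, it suffices to bound S(x), for every c < 1 and all large x, by
x^2 exp(-c L); the function eps is then read off from S(x).

For a prime p not dividing a2 times the discriminant there is a rank of
appearance z(p), prime to p and at most p + 1, such that p divides u_n exactly
when z(p) divides n ([rank_of_appearance]). Let p be the largest prime factor
of g(n). Then p z(p) divides n, and g(n) is at most the p-smooth part of n.
Summing over the multiples n of p z(p), and treating together all n for which
p <= Y = exp(L/2), yields ([sum_gcd_le_smooth])

   S(x) <= x (Psi(x, Y) + sum_(Y < p <= x) Psi(x / (p z(p)), p)),

where Psi(t, p) counts the p-smooth integers up to t.

Rankin's method ([smooth_count_le]) bounds Psi(t, p) by t^(1-d) times
exp(4 p^d sum_(q <= p) 1/q). For a fixed b < 1, d is chosen so that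
p^d = l^(b/2). As the sum of 1/q over primes q <= x is O(w)
([sum_inv_primes_le]), the exponential factor is exp(o(L)), and
x^(-d) = exp(-b L^2 / (2 ln p)). By the inequality of the arithmetic and
geometric means this is at most exp(-b L) sqrt p, so that the term of p is at
most x exp(-b L + o(L)) / (sqrt p z(p)) ([smooth_count_large_prime]).

It remains to see that the sum of 1 / (sqrt p z(p)) is O(l). Now
1 / (sqrt p z(p)) <= 1/p + 1/z(p)^2, and only O(k) primes satisfy z(p) = k,
because they all divide u_k, which is nonzero by nondegeneracy and at most
exponential in k ([sum_sqrt_rank_le]). *)

(** * Lucas sequences and ranks of appearance *)

(** Binet's formula, without division, in any ring over which the
characteristic polynomial splits. *)
Lemma lucas_binet (K : comNzRingType) (a1 a2 : int) (u : nat -> int)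
    (alpha beta : K) :
    is_lucas a1 a2 u -> alpha + beta = a1%:~R -> alpha * beta = - a2%:~R ->
  forall n, (u n)%:~R * (alpha - beta) = alpha ^+ n - beta ^+ n.
Proof.
move=> [_ u0 u1 urec] Es Ep n.
suff [] : (u n)%:~R * (alpha - beta) = alpha ^+ n - beta ^+ n /\
  (u n.+1)%:~R * (alpha - beta) = alpha ^+ n.+1 - beta ^+ n.+1 by [].
elim: n => [|n [IH0 IH1]]; first by rewrite u0 u1 !expr0 !expr1 mul0r mul1r subrr.
split=> //; rewrite urec //= rmorphD !rmorphM /=.
have -> : a2%:~R = - (alpha * beta) by rewrite Ep opprK.
rewrite mulrDl -!mulrA IH0 IH1 -Es !exprS; ring.
Qed.

Lemma charpoly_roots (K : closedFieldType) (a b : K) :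
  exists alpha beta, alpha + beta = a /\ alpha * beta = - b.
Proof.
have sz : size ('X^2 - a *: 'X - b%:P : {poly K}) != 1%N.
  rewrite -addrA size_polyDl size_polyXn //.
  apply: leq_ltn_trans (size_polyD _ _) _.
  rewrite !size_polyN gtn_max (leq_ltn_trans (size_scale_leq _ _)) ?size_polyX //.
  by rewrite size_polyC; case: (b == 0).
have [al] := closed_rootP _ sz.
rewrite rootE !hornerE => /eqP Hal.
exists al, (a - al); split; first by ring.
transitivity (- b - (al ^+ 2 - a * al - b)); first by ring.
by rewrite Hal subr0.
Qed.

Lemma sqr_root_diff (K : comNzRingType) (a1 a2 : int) (alpha beta : K) :
  alpha + beta = a1%:~R -> alpha * beta = - a2%:~R ->
  (alpha - beta) ^+ 2 = (lucas_disc a1 a2)%:~R.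
Proof.
move=> Es Ep; rewrite /lucas_disc rmorphD rmorphXn rmorphM /= -Es.
have -> : a2%:~R = - (alpha * beta) by rewrite Ep opprK.
by ring.
Qed.

Lemma lucas_neq0 (R : realType) (a1 a2 : int) (u : nat -> int) :
    is_lucas a1 a2 u -> lucas_nondegenerate R a1 a2 ->
    lucas_disc a1 a2 != 0 ->
  forall n, (0 < n)%N -> u n != 0.
Proof.
move=> lu nd D0 n n0; apply/negP => /eqP un0.
have [al [be [Es Ep]]] :=
  charpoly_roots (a1%:~R : complex R) (a2%:~R : complex R).
have [a20 _ _ _] := lu.
have isroot z : z = al \/ z = be ->
    root (map_poly intr (lucas_charpoly a1 a2)) z.
  move=> Hz; rewrite /lucas_charpoly rootE !rmorphB /= map_polyXn map_polyC /=.
  rewrite map_polyZ map_polyX !hornerE.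
  suff -> : z ^+ 2 - a1%:~R * z - a2%:~R = 0 by [].
  rewrite -Es (_ : a2%:~R = - (al * be)); last by rewrite Ep opprK.
  by case: Hz => ->; ring.
have neq : al != be.
  rewrite -subr_eq0 -sqrf_eq0 (sqr_root_diff Es Ep) intr_eq0 //.
have be0 : be != 0.
  apply: contraNneq a20 => b0; move: Ep; rewrite b0 mulr0 => /eqP.
  by rewrite eq_sym oppr_eq0 intr_eq0.
apply: (nd al be (isroot _ (or_introl erefl)) (isroot _ (or_intror erefl)) neq).
exists n => //; apply/unity_rootP; rewrite expr_div_n.
have /eqP := lucas_binet lu Es Ep n.
rewrite un0 mul0r eq_sym subr_eq0 => /eqP ->.
by rewrite divff // expf_neq0.
Qed.

(** The rank is the multiplicative order of alpha / beta, where alpha and beta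
are the roots of the characteristic polynomial in an algebraic closure of the
field with p elements. It divides p - 1 or p + 1, since the Frobenius map
permutes the two roots. *)
Lemma rank_of_appearance (a1 a2 : int) (u : nat -> int) (p : nat) :
    is_lucas a1 a2 u -> prime p ->
    ~~ (p %| `|a2|)%N -> ~~ (p %| `|lucas_disc a1 a2|)%N ->
  exists z, [/\ (0 < z)%N, (z <= p.+1)%N, coprime p z
    & forall n, (p %| `|u n|)%N = (z %| n)%N].
Proof.
move=> lu pp pa2 pD.
have [K [f _]] := countable_algebraic_closure 'F_p.
have chK : p \in [pchar K] by rewrite (fmorph_pchar f) pchar_Fp.
have int0 (m : int) : ((m%:~R : K) == 0) = (p %| `|m|)%N.
  by rewrite -(dvdz_pcharf chK).
have [al [be [Es Ep]]] := charpoly_roots (a1%:~R : K) (a2%:~R : K).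
have neq : al - be != 0.
  by rewrite -sqrf_eq0 (sqr_root_diff Es Ep) int0.
have : al * be != 0 by rewrite Ep oppr_eq0 int0.
rewrite mulf_eq0 negb_or => /andP[al0 be0].
have un0 n : (p %| `|u n|)%N = ((al / be) ^+ n == 1).
  rewrite -int0 -(mulIr_eq0 _ (mulIf neq)) (lucas_binet lu Es Ep) subr_eq0.
  rewrite expr_div_n; apply/eqP/eqP => [->|/divr1_eq //].
  by rewrite divff // expf_neq0.
(* q is p - 1 if Frobenius fixes alpha, and p + 1 if it exchanges the roots. *)
have [q [q0 qp1 qE]] : exists q, [/\ (0 < q)%N, (q <= p.+1)%N /\ coprime p q
    & (al / be) ^+ q = 1].
  have Es' : al ^+ p + be ^+ p = a1%:~R.
    by rewrite -!(pFrobenius_autE chK) -rmorphD Es rmorph_int.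
  have Ep' : al ^+ p * be ^+ p = - a2%:~R.
    by rewrite -!(pFrobenius_autE chK) -rmorphM Ep rmorphN rmorph_int.
  have : (al ^+ p - al) * (al ^+ p - be) = 0.
    transitivity (al ^+ p * (al ^+ p - (al + be)) + al * be); first by ring.
    by rewrite Es Ep -Es' -Ep'; ring.
  move/eqP; rewrite mulf_eq0 !subr_eq0 => /orP[] /eqP Hal.
    have Hbe : be ^+ p = be by apply: (addrI al); rewrite -{1}Hal Es' Es.
    exists p.-1; split; first by rewrite -ltnS prednK ?prime_gt1 ?prime_gt0.
      split; first by rewrite leqW // leq_pred.
      by rewrite coprimenP // prime_gt0.
    rewrite expr_div_n; have E (z : K) : z ^+ p = z -> z != 0 -> z ^+ p.-1 = 1.
      move=> Hz z0; apply: (mulfI z0).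
      by rewrite -exprS prednK ?prime_gt0 // Hz mulr1.
    by rewrite !E // divr1.
  have Hbe : be ^+ p = al by apply: (addrI be); rewrite -{1}Hal Es' addrC Es.
  exists p.+1; split=> //; first by split=> //; exact: coprimenS.
  by rewrite expr_div_n !exprS Hal Hbe [be * al]mulrC divff // mulf_neq0.
have [z zprim zq] := prim_order_exists q0 qE.
exists z; split.
- exact: prim_order_gt0 zprim.
- by apply: leq_trans (dvdn_leq q0 zq) _; case: qp1.
- by case: qp1 => _; exact: coprime_dvdr.
- by move=> n; rewrite un0 -(prim_order_dvd zprim).
Qed.

(** * Counting primes *)

Lemma expn_size_primes (B m : nat) (s : seq nat) :
    (0 < m)%N -> uniq s ->
    (forall p, p \in s -> [/\ prime p, (p %| m)%N & (B <= p)%N]) ->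
  (B ^ size s <= m)%N.
Proof.
move=> m0 us sP.
have le_prod : (B ^ size s <= \prod_(p <- s) p)%N.
  elim: s sP {us} => [|p s IHs] sP; first by rewrite big_nil.
  rewrite big_cons expnS leq_mul //.
    by case: (sP p (mem_head _ _)).
  by apply: IHs => q qs; apply: sP; rewrite inE qs orbT.
apply: leq_trans le_prod _; apply: dvdn_leq => //.
elim: s sP us => [|p s IHs] sP; first by rewrite big_nil.
have [pp pm _] := sP p (mem_head _ _).
have sP' q : q \in s -> [/\ prime q, (q %| m)%N & (B <= q)%N].
  by move=> qs; apply: sP; rewrite inE qs orbT.
rewrite cons_uniq big_cons => /andP[ps us].
rewrite Gauss_dvd ?pm ?IHs // prime_coprime // Euclid_dvd_prod // big_has.
apply/hasPn => q qs; have [pq _ _] := sP' q qs.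
by rewrite dvdn_prime2 //; apply: contraNneq ps => ->.
Qed.

Lemma bin_le_exp2 n m : ('C(n, m) <= 2 ^ n)%N.
Proof.
elim: n m => [|n IHn] [|m] //; first by rewrite bin0 expn_gt0.
by rewrite binS expnS mul2n -addnn leq_add.
Qed.

Lemma prime_dvd_fact p n : prime p -> (p %| n`!)%N = (p <= n)%N.
Proof.
move=> pp; apply/idP/idP => [|pn]; last by rewrite dvdn_fact // prime_gt0.
elim: n => [|n IHn]; first by rewrite dvdn1 => /eqP p1; rewrite p1 in pp.
rewrite factS Euclid_dvdM // => /orP[/dvdn_leq -> //|/IHn/leqW //].
Qed.

(** Chebyshev's argument: every prime in (n, 2n], with n = 2^j, divides the
central binomial coefficient, which is at most 4^n. *)
Lemma count_primes_doubling j :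
  (j * count prime (index_iota (2 ^ j).+1 (2 ^ j.+1).+1) <= 2 ^ j.+1)%N.
Proof.
set s := index_iota _ _; set n := (2 ^ j)%N.
have n2 : (2 ^ j.+1 = n + n)%N by rewrite expnS mul2n addnn.
have n0 : (0 < n)%N by rewrite expn_gt0.
have H : (n ^ size [seq p <- s | prime p] <= 'C(n + n, n))%N.
  apply: expn_size_primes; first by rewrite bin_gt0 leq_addr.
    by rewrite filter_uniq // iota_uniq.
  move=> p; rewrite mem_filter mem_index_iota ltnS n2 => /and3P[pp np pn].
  split=> //; last exact: ltnW.
  have : (p %| (n + n)`!)%N by rewrite prime_dvd_fact.
  rewrite -(bin_fact (leq_addr n n)) addnK !Euclid_dvdM // !prime_dvd_fact //.
  by rewrite leqNgt np !orbF.
rewrite -(leq_exp2l (m := 2)) // expnM -/n -size_filter.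
by apply: leq_trans H _; rewrite n2 bin_le_exp2.
Qed.

(** The terms of a Lucas sequence grow at most exponentially. *)
Lemma lucas_bound (a1 a2 : int) (u : nat -> int) :
  is_lucas a1 a2 u -> forall n, (`|u n| <= (`|a1| + `|a2|) ^ n)%N.
Proof.
move=> [a20 u0 u1 urec] n; set C := (_ + _)%N.
have C0 : (0 < C)%N by rewrite addn_gt0 !absz_gt0 a20 orbT.
suff [] : ((`|u n| <= C ^ n) /\ (`|u n.+1| <= C ^ n.+1))%N by [].
elim: n => [|n [IH0 IH1]]; first by rewrite u0 u1.
split=> //; rewrite urec //=.
have absD (x y : int) : (absz (x + y)%R <= `|x| + `|y|)%N by lia.
apply: leq_trans (absD _ _) _; rewrite !abszM expnS {2}/C mulnDl leq_add //.
  by rewrite leq_mul.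
by rewrite leq_mul // (leq_trans IH0) // leq_pexp2l.
Qed.

(** Only few primes can have a given rank of appearance k, since all of them
divide the nonzero term of index k. *)
Lemma size_primes_of_rank (a1 a2 : int) (u : nat -> int) (k : nat) (s : seq nat) :
    is_lucas a1 a2 u -> u k != 0 -> uniq s ->
    (forall p, p \in s -> prime p /\ (p %| `|u k|)%N) ->
  (size s <= (`|a1| + `|a2|) * k)%N.
Proof.
move=> lu uk0 us sP.
rewrite -(leq_exp2l (m := 2)) //.
have /leq_trans : (2 ^ size s <= `|u k|)%N.
  apply: expn_size_primes => //; first by rewrite absz_gt0.
  by move=> p /sP[pp pu]; split=> //; exact: prime_gt1.
apply; apply: leq_trans (lucas_bound lu k) _.
case: k uk0 {sP} => [|k] _; first by rewrite muln0.
by rewrite expnM leq_exp2r // ltnW // ltn_expl.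
Qed.

(** * Reduction to counting smooth numbers *)

Lemma big_multiples (T : Type) (idx : T) (op : Monoid.law idx) (d N : nat)
    (F : nat -> T) : (0 < d)%N ->
  \big[op/idx]_(1 <= n < N.+1 | (d %| n)%N) F n =
  \big[op/idx]_(1 <= m < (N %/ d).+1) F (d * m)%N.
Proof.
move=> d0; rewrite big_mkcond; elim: N => [|N IHN].
  by rewrite div0n !big_geq.
rewrite big_nat_recr //= IHN divnS //; case: (boolP (d %| N.+1)%N) => dN.
  rewrite add1n [RHS]big_nat_recr //=; congr (op _ (F _)).
  by rewrite -[LHS](divnK dN) divnS // dN mulnC.
by rewrite add0n Monoid.mulm1.
Qed.

Lemma sum_multiples (d N : nat) (F : nat -> nat) : (0 < d)%N ->
  (\sum_(1 <= n < N.+1) (d %| n) * F n =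
   \sum_(1 <= m < (N %/ d).+1) F (d * m))%N.
Proof.
move=> d0; rewrite -big_multiples // [RHS]big_mkcond /=.
by apply: eq_bigr => n _; rewrite mulnbl.
Qed.

(** The primes up to P; a number is a [primes_upto P].-number when it is
P-smooth. *)
Definition primes_upto (P : nat) : nat_pred := [pred p | (p <= P)%N].

(** The number of P-smooth integers between 1 and M. *)
Definition smooth_count (P M : nat) : nat :=
  count (pnat (primes_upto P)) (index_iota 1 M.+1).

(** Grouping the n <= N by their P-smooth part s, each s contributes at most
s * (N / s). *)
Lemma sum_partn (P N : nat) :
  (\sum_(1 <= n < N.+1) n`_(primes_upto P) <= N * smooth_count P N)%N.
Proof.
set pi := primes_upto P.
have le_part n : (1 <= n < N.+1)%N ->
    (n`_pi <= \sum_(1 <= s < N.+1 | pi.-nat s) (s %| n) * s)%N.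
  move=> /andP[n0 nN].
  rewrite (big_rem (n`_pi)%N) /= ?part_pnat ?dvdn_part ?mul1n ?leq_addr //.
  rewrite mem_index_iota part_gt0 (leq_ltn_trans _ nN) //.
  by rewrite dvdn_leq ?dvdn_part.
rewrite big_nat_cond.
apply: (@leq_trans (\sum_(1 <= n < N.+1) \sum_(1 <= s < N.+1 | pi.-nat s) (s %| n) * s)%N).
  rewrite [leqRHS]big_nat_cond; apply: leq_sum => n; rewrite andbT; exact: le_part.
rewrite exchange_big_nat /= /smooth_count -sum1_count big_distrr /=.
rewrite big_nat_cond [leqRHS]big_nat_cond; apply: leq_sum => s /andP[/andP[s0 _] _].
rewrite (sum_multiples _ (fun=> s)) // sum_nat_const_nat subn1 /= muln1.
exact: leq_trunc_div.
Qed.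

(** For n = q m the smooth part of q is at most q, which is made up for by the
fact that m only runs up to N / q. *)
Lemma sum_partn_multiples (P N q : nat) : (0 < q)%N ->
  (\sum_(1 <= n < N.+1) (q %| n) * n`_(primes_upto P) <=
   N * smooth_count P (N %/ q))%N.
Proof.
move=> q0; rewrite sum_multiples //.
apply: (@leq_trans (q * \sum_(1 <= m < (N %/ q).+1) m`_(primes_upto P))%N).
  rewrite big_distrr /= big_nat_cond [leqRHS]big_nat_cond.
  apply: leq_sum => m /andP[/andP[m0 _] _].
  by rewrite partnM // leq_mul // dvdn_leq // dvdn_part.
apply: (@leq_trans (q * (N %/ q * smooth_count P (N %/ q)))%N).
  by rewrite leq_mul // sum_partn.
by rewrite mulnA leq_mul // mulnC leq_trunc_div.
Qed.

(** The sum on the right is over the largest prime factor p of the greatest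
common divisor; the first term accounts for those n for which p <= Y. *)
Lemma sum_gcd_le_smooth (u : nat -> int) (z : nat -> nat) (Y N : nat) :
    (forall p, prime p -> (Y < p)%N -> [/\ (0 < z p)%N, coprime p (z p) &
      forall n, (p %| `|u n|)%N = (z p %| n)%N]) ->
  (\sum_(1 <= n < N.+1) gcdn n `|u n| <=
   N * (smooth_count Y N +
        \sum_(Y.+1 <= p < N.+1 | prime p) smooth_count p (N %/ (p * z p))))%N.
Proof.
move=> zP.
have le_g n : (1 <= n < N.+1)%N -> (gcdn n `|u n| <= n`_(primes_upto Y) +
    \sum_(Y.+1 <= p < N.+1 | prime p) (p * z p %| n) * n`_(primes_upto p))%N.
  move=> /andP[n0 nN]; set g := gcdn _ _.
  have g0 : (0 < g)%N by rewrite gcdn_gt0 n0.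
  have gn : (g %| n)%N by rewrite dvdn_gcdl.
  have gP P : (max_pdiv g <= P)%N -> (g <= n`_(primes_upto P))%N.
    move=> gP; rewrite dvdn_leq ?part_gt0 //.
    rewrite -{1}(@part_pnat_id (primes_upto P) g) ?partn_dvd //.
    apply/pnatP => // p pp pg; rewrite inE (leq_trans _ gP) //.
    by rewrite max_pdiv_max // inE /= mem_primes pp g0 pg.
  case: (leqP (max_pdiv g) Y) => [/gP/leq_trans -> //|Yp]; first exact: leq_addr.
  have [g1|g1] := leqP g 1.
    rewrite (leq_trans g1) // (leq_trans _ (leq_addr _ _)) // part_gt0 //.
  have pp := max_pdiv_prime g1; have pg := max_pdiv_dvd g.
  have [z0 cz zE] := zP _ pp Yp.
  rewrite (big_rem (max_pdiv g)) /=; last first.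
    rewrite mem_index_iota Yp (leq_ltn_trans _ nN) //.
    by rewrite dvdn_leq // (dvdn_trans pg).
  rewrite pp Gauss_dvd // (dvdn_trans pg gn) -zE.
  rewrite (dvdn_trans pg (dvdn_gcdr _ _)) mul1n.
  by rewrite addnCA (leq_trans (gP _ (leqnn _))) // leq_addr.
apply: (@leq_trans (\sum_(1 <= n < N.+1) n`_(primes_upto Y) +
  \sum_(1 <= n < N.+1) \sum_(Y.+1 <= p < N.+1 | prime p)
     (p * z p %| n) * n`_(primes_upto p))%N).
  rewrite -big_split /= big_nat_cond [leqRHS]big_nat_cond.
  by apply: leq_sum => n; rewrite andbT; exact: le_g.
rewrite mulnDr leq_add ?sum_partn // exchange_big_nat big_distrr /=.
rewrite big_nat_cond [leqRHS]big_nat_cond.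
apply: leq_sum => p /andP[/andP[Yp _] pp]; have [z0 _ _] := zP p pp Yp.
by rewrite sum_partn_multiples // muln_gt0 prime_gt0.
Qed.

(** * Rankin's bound for smooth numbers *)

Lemma pnat_primes_upto (P n : nat) : (0 < n)%N ->
  reflect (forall p, prime p -> (p %| n)%N -> (p <= P)%N)
    ((primes_upto P).-nat n).
Proof. by move=> n0; exact: (iffP (pnatP _ n0)). Qed.

Lemma invr_expRN4_ge (R : realType) (t : R) :
  0 <= t -> t <= 3 / 4 -> expR (- (4 * t)) <= 1 - t.
Proof.
move=> t0 t1; rewrite expRN -[leRHS]invrK lef_pV2 ?posrE ?expR_gt0 ?invr_gt0 //; last lra.
apply: le_trans (expR_ge1Dx _).
rewrite -div1r ler_pdivrMr; last lra.
have : 0 <= t * (3 - 4 * t) by rewrite mulr_ge0 //; lra.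
lra.
Qed.

Lemma ler_sum_subset (R : numDomainType) (I : eqType) (r : seq I)
    (P Q : pred I) (F : I -> R) :
    (forall i, i \in r -> P i -> Q i) -> (forall i, 0 <= F i) ->
  \sum_(i <- r | P i) F i <= \sum_(i <- r | Q i) F i.
Proof.
move=> PQ F0; rewrite big_mkcond [leRHS]big_mkcond /= !big_seq.
apply: ler_sum => i ir; have := PQ i ir.
by case: (P i) => [-> //|_]; case: (Q i).
Qed.

(** A finite Euler product bound: each new prime p multiplies the sum over
smooth numbers by at most 1 / (1 - f p) <= exp(4 f p), by splitting off the multiples
of p. *)
Lemma smooth_sum_le (R : realType) (f : nat -> R) (P M : nat) :
    f 1%N = 1 -> (forall m n, f (m * n)%N = f m * f n) ->
    (forall n, 0 <= f n) -> (forall p, prime p -> f p <= 3 / 4) ->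
  \sum_(1 <= s < M.+1 | (primes_upto P).-nat s) f s <=
    expR (4 * \sum_(1 <= p < P.+1 | prime p) f p).
Proof.
move=> f1 fM f0 fp.
set A := fun P => \sum_(1 <= s < M.+1 | (primes_upto P).-nat s) f s.
rewrite -/(A P); elim: P => [|P IHP].
  rewrite [X in expR (4 * X)]big_geq // mulr0 expR0 /A.
  case: M {A} => [|M]; first by rewrite big_geq.
  rewrite big_ltn_cond //= big1_seq ?addr0 ?f1 // => s.
  rewrite mem_index_iota => /andP[+ /andP[s1 _]].
  move=> /(pnat_primes_upto _ (ltnW s1)) /(_ _ (pdiv_prime s1) (pdiv_dvd _)).
  by rewrite leqNgt pdiv_gt0.
have -> : \sum_(1 <= p < P.+2 | prime p) f p =
    \sum_(1 <= p < P.+1 | prime p) f p + (if prime P.+1 then f P.+1 else 0).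
  by rewrite big_mkcond big_nat_recr //= -big_mkcond.
have [pp|npp] := boolP (prime P.+1); last first.
  rewrite addr0; apply: le_trans IHP.
  apply: ler_sum_subset => // s; rewrite mem_index_iota => /andP[s0 _].
  move=> /(pnat_primes_upto _ s0) sP; apply/pnat_primes_upto => // q pq qs.
  have := sP q pq qs; rewrite leq_eqVlt ltnS => /predU1P[qP|//].
  by rewrite -qP pq in npp.
have fP0 := fp _ pp.
have step : A P.+1 * (1 - f P.+1) <= A P.
  rewrite mulrBr mulr1 lerBlDr [in leLHS]/A (bigID (dvdn P.+1)) /= addrC lerD //.
    apply: ler_sum_subset => // s; rewrite mem_index_iota => /andP[s0 _].
    move=> /andP[/(pnat_primes_upto _ s0) sP Ps]; apply/pnat_primes_upto => // q pq qs.
    have := sP q pq qs; rewrite leq_eqVlt ltnS => /predU1P[qP|//].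
    by rewrite -qP qs in Ps.
  under eq_bigl do rewrite andbC.
  rewrite big_mkcondr big_multiples //=.
  rewrite (@big_nat_widen _ _ _ 1 _ M.+1) ?ltnS ?leq_div //.
  rewrite mulr_suml [leRHS]big_mkcond [leLHS]big_mkcond /=; apply: ler_sum => m _.
  rewrite fM mulrC pnatM.
  case: ifP => _; last by case: ifP => //; rewrite mulr_ge0.
  case: ((primes_upto P.+1).-nat m); last by rewrite andbF.
  by rewrite andbT; case: ifP; rewrite ?mulr_ge0.
have t1 : 0 < 1 - f P.+1 by lra.
rewrite mulrDr expRD -ler_pdivrMr ?expR_gt0 // -expRN.
apply: le_trans IHP; apply: le_trans step.
apply: ler_wpM2l; last exact: invr_expRN4_ge.
by apply: sumr_ge0.
Qed.

(** Rankin's method: each s counted is given the weight (X / s)^(1 - d) >= 1,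
and the sum of the weights is bounded by the Euler product, where
q^(d - 1) <= P^d / q for the primes q <= P. *)
Lemma smooth_count_le (R : realType) (P M : nat) (X d : R) :
    M%:R <= X -> 0 < X -> 0 <= d -> d <= 1 / 2 ->
  (smooth_count P M)%:R <= X `^ (1 - d) *
    expR (4 * (P%:R `^ d * \sum_(1 <= p < P.+1 | prime p) p%:R^-1)).
Proof.
move=> MX X0 d0 d1.
pose f n : R := n%:R `^ (d - 1).
have fM m n : f (m * n)%N = f m * f n by rewrite /f natrM powRM.
have f0 n : 0 <= f n by exact: powR_ge0.
have f1 : f 1%N = 1 by rewrite /f powR1.
have Ed : d - 1 = - (1 - d) by lra.
have fp p : prime p -> f p <= 3 / 4.
  move=> pp; apply: (@le_trans _ _ ((2%:R : R) `^ (d - 1))).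
    rewrite /f Ed !powRN lef_pV2 ?posrE ?powR_gt0 ?ltr0n ?prime_gt0 //.
    by apply: ge0_ler_powR; rewrite ?nnegrE ?ler0n ?ler_nat ?prime_gt1 //; lra.
  apply: (@le_trans _ _ ((2%:R : R) `^ (- (2^-1)))).
    by apply: ler_powR; [rewrite ler1n | lra].
  rewrite powRN -[leRHS]invrK lef_pV2 ?posrE ?powR_gt0 ?invr_gt0 //.
  rewrite powR12_sqrt //.
  have <- : Num.sqrt ((4 / 3) ^+ 2) = (3 / 4)^-1 :> R.
    by rewrite sqrtr_sqr ger0_norm; [field | lra].
  by rewrite ler_sqrt; lra.
have := smooth_sum_le P M f1 fM f0 fp; set A := \sum_(_ <= s < _ | _) _ => HA.
apply: (@le_trans _ _ (X `^ (1 - d) * A)); last first.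
  apply: ler_wpM2l; first exact: powR_ge0.
  apply: le_trans HA _; rewrite ler_expR ler_wpM2l // big_distrr /=.
  rewrite big_nat_cond [leRHS]big_nat_cond; apply: ler_sum => p.
  move=> /andP[/andP[p0 pP] pp].
  have p0' : (p%:R : R) != 0 by rewrite pnatr_eq0 -lt0n.
  rewrite /f powRD ?p0' ?implybT // powR_inv1 ?ler0n //.
  rewrite ler_wpM2r ?invr_ge0 ?ler0n //.
  by apply: ge0_ler_powR; rewrite ?nnegrE ?ler0n ?ler_nat -1?ltnS.
rewrite /smooth_count -sum1_count natr_sum big_distrr /=.
rewrite big_nat_cond [leRHS]big_nat_cond; apply: ler_sum => s.
move=> /andP[/andP[s0 sM] _].
rewrite /f Ed powRN ler_pdivlMr ?powR_gt0 ?ltr0n // mul1r.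
apply: ge0_ler_powR; rewrite ?nnegrE ?ler0n //; [lra|exact: ltW|].
by apply: le_trans MX; rewrite ler_nat -ltnS.
Qed.

(** * Sums over primes *)

Lemma harmonic_le (R : realType) (n : nat) :
  \sum_(1 <= j < n.+2) (j%:R : R)^-1 <= 1 + ln n.+1%:R.
Proof.
elim: n => [|n IHn]; first by rewrite big_nat1 invr1 ln1 addr0.
rewrite big_nat_recr //=.
have n1 : 0 < n.+1%:R :> R by rewrite ltr0n.
have n2 : 0 < n.+2%:R :> R by rewrite ltr0n.
have : ln (1 + - (n.+2%:R : R)^-1) <= - (n.+2%:R)^-1.
  by apply: le_ln1Dx; rewrite ltrN2 invf_lt1 // ltr1n.
have -> : 1 + - (n.+2%:R : R)^-1 = n.+1%:R / n.+2%:R.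
  by move: n2; rewrite -(@natr1 R n.+1) => n2; field; rewrite gt_eqF.
rewrite ln_div ?posrE // => H.
have {}H : n.+2%:R^-1 <= ln n.+2%:R - ln n.+1%:R :> R by rewrite -lerN2 opprB.
by apply: le_trans (lerD IHn H) _; rewrite -addrA [ln n.+1%:R + _]addrC subrK.
Qed.

Lemma ln2_ge_half (R : realType) : 1 / 2 <= ln 2 :> R.
Proof.
have : ln (1 + - (2 : R)^-1) <= - 2^-1 by apply: le_ln1Dx; lra.
have -> : 1 + - (2 : R)^-1 = 2^-1 by lra.
by rewrite lnV ?posrE //; lra.
Qed.

(** A weak form of Mertens' second theorem: the primes in (2^j, 2^(j+1)]
contribute at most 2 / j. *)
Lemma sum_inv_primes_exp2 (R : realType) (J : nat) :
  \sum_(1 <= p < (2 ^ J).+1 | prime p) (p%:R : R)^-1 <=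
    1 + 2 * \sum_(1 <= j < J) (j%:R)^-1.
Proof.
case: J => [|J].
  rewrite [X in _ <= 1 + 2 * X]big_geq // mulr0 addr0 big_mkcond big_nat1 /=.
  by rewrite ler01.
elim: J => [|J IHJ].
  rewrite [X in _ <= 1 + 2 * X]big_geq // mulr0 addr0 big_mkcond.
  rewrite expn1 big_ltn // big_nat1 /= add0r; lra.
have le2 : ((2 ^ J.+1).+1 <= (2 ^ J.+2).+1)%N by rewrite ltnS leq_exp2l.
rewrite (big_cat_nat (n := (2 ^ J.+1).+1)) //= [X in 1 + 2 * X]big_nat_recr //=.
rewrite mulrDr addrA lerD //.
have p2 : 0 < (2 ^ J.+1)%:R :> R by rewrite ltr0n expn_gt0.
have J0 : 0 < J.+1%:R :> R by rewrite ltr0n.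
apply: (@le_trans _ _ ((count prime (index_iota (2 ^ J.+1).+1 (2 ^ J.+2).+1))%:R
  / (2 ^ J.+1)%:R)).
  rewrite -sum1_count natr_sum mulr_suml.
  rewrite big_nat_cond [leRHS]big_nat_cond; apply: ler_sum => p.
  move=> /andP[/andP[p0 _] _]; rewrite mul1r lef_pV2 ?posrE //.
    by rewrite ler_nat ltnW.
  by apply: lt_le_trans p2 _; rewrite ler_nat ltnW.
rewrite ler_pdivrMr // mulrAC ler_pdivlMr // mulrC -!natrM ler_nat.
by rewrite (leq_trans (count_primes_doubling _)) // expnS.
Qed.

Lemma sum_inv_primes_le (R : realType) (P : nat) (x : R) :
    P%:R <= x -> 1 <= ln x ->
  \sum_(1 <= p < P.+1 | prime p) (p%:R : R)^-1 <= 3 + 2 * ln (2 * ln x).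
Proof.
move=> Px l1.
have x0 : 0 < x by rewrite ltNge; apply/negP => /ln0 x0; move: l1; rewrite x0; lra.
(* As ln 2 >= 1/2, the power 2^(k+1) exceeds x. *)
pose k := Num.truncn (2 * ln x).
have k_le : k%:R <= 2 * ln x by rewrite truncn_le; lra.
have k_gt : 2 * ln x < k.+1%:R by rewrite truncnS_gt.
have k0 : (0 < k)%N by rewrite truncn_gt0; lra.
have P2 : (P <= 2 ^ k.+1)%N.
  rewrite -(ler_nat R) (le_trans Px) // -ler_ln ?posrE ?ltr0n ?expn_gt0 //.
  rewrite natrX lnXn // -[leRHS]mulr_natl.
  have := ln2_ge_half R; have : 0 < k.+1%:R :> R by rewrite ltr0n.
  nra.
apply: (@le_trans _ _ (\sum_(1 <= p < (2 ^ k.+1).+1 | prime p) (p%:R : R)^-1)).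
  rewrite [leLHS](@big_nat_widen _ _ _ 1 _ (2 ^ k.+1).+1) ?ltnS //.
  apply: ler_sum_subset => [i _ /andP[] //|i]; by rewrite invr_ge0 ler0n.
apply: le_trans (sum_inv_primes_exp2 R k.+1) _.
case: k k0 k_le {k_gt P2} => // k _ k_le.
have := harmonic_le R k.
have : ln k.+1%:R <= ln (2 * ln x).
  by rewrite ler_ln ?posrE ?ltr0n //; lra.
lra.
Qed.

(** The terms are split by 1 / (s t) <= 1 / s^2 + 1 / t^2 into a harmonic sum
and the sum of 1 / z(p)^2; the latter is also harmonic up to a constant, as at
most O(k) primes have rank k. *)
Lemma sum_sqrt_rank_le (R : realType) (a1 a2 : int) (u : nat -> int)
    (z : nat -> nat) (Y N : nat) (x : R) :
    is_lucas a1 a2 u -> (forall k, (0 < k)%N -> u k != 0) ->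
    (forall p, prime p -> (Y < p)%N ->
      [/\ (0 < z p)%N, (z p <= p.+1)%N & (p %| `|u (z p)|)%N]) ->
    1 <= x -> N%:R <= x ->
  \sum_(Y.+1 <= p < N.+1 | prime p) (Num.sqrt p%:R * (z p)%:R)^-1 <=
    (1 + (`|a1| + `|a2|)%:R) * (2 + ln x) :> R.
Proof.
move=> lu u0 zP x1 Nx; set c := (_ + _)%N.
have hN n : (n <= N.+1)%N -> \sum_(1 <= j < n.+1) (j%:R : R)^-1 <= 2 + ln x.
  have l0 : 0 <= ln x by exact: ln_ge0.
  case: n => [|n] nN; first by rewrite big_geq //; lra.
  apply: le_trans (harmonic_le R n) _.
  have : ln n.+1%:R <= ln (2 * x).
    rewrite ler_ln ?posrE ?ltr0n //; last lra.
    apply: (@le_trans _ _ (N.+1%:R)); first by rewrite ler_nat.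
    by rewrite -natr1; lra.
  rewrite lnM ?posrE //; last lra.
  have : ln (2 : R) <= 1 by have := @le_ln1Dx R 1; rewrite (_ : 1 + 1 = 2) //; lra.
  lra.
apply: (@le_trans _ _ (\sum_(Y.+1 <= p < N.+1 | prime p)
    (p%:R^-1 + ((z p)%:R ^+ 2)^-1))).
  rewrite big_nat_cond [leRHS]big_nat_cond; apply: ler_sum => p.
  move=> /andP[/andP[Yp pN] pp]; have [z0 _ _] := zP p pp Yp.
  rewrite invfM -[X in _ <= X^-1 + _](sqr_sqrtr (ler0n R p)) -!exprVn.
  set s := _^-1; set t := _^-1; nra.
rewrite big_split /= mulrDl mul1r lerD //.
  apply: le_trans (hN N (leqnSn _)); rewrite (@big_nat_widenl _ _ _ Y.+1 1) //.
  by apply: ler_sum_subset => // i; rewrite invr_ge0 ler0n.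
pose F k : R := (k%:R ^+ 2)^-1.
apply: (@le_trans _ _ (\sum_(Y.+1 <= p < N.+1 | prime p)
    \sum_(1 <= k < N.+2) (z p == k)%:R * F k)).
  rewrite big_nat_cond [leRHS]big_nat_cond; apply: ler_sum => p.
  move=> /andP[/andP[Yp pN] pp]; have [z0 zp _] := zP p pp Yp.
  rewrite (big_rem (z p)) /=; last first.
    by rewrite mem_index_iota z0 ltnS (leq_trans zp).
  rewrite eqxx mul1r lerDl sumr_ge0 // => k _.
  by rewrite mulr_ge0 ?ler0n // invr_ge0 exprn_ge0 ?ler0n.
rewrite exchange_big_nat /=.
apply: le_trans (ler_wpM2l (ler0n R c) (hN N.+1 (leqnn _))).
rewrite big_distrr /= big_nat_cond [leRHS]big_nat_cond; apply: ler_sum => k.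
move=> /andP[/andP[k0 _] _]; rewrite -mulr_suml -natr_sum.
have kR : 0 < k%:R :> R by rewrite ltr0n.
rewrite ler_pdivrMr ?exprn_gt0 // expr2 mulrA mulfVK ?gt_eqF // -natrM ler_nat.
pose s := [seq p <- index_iota Y.+1 N.+1 | prime p && (z p == k)].
have -> : (\sum_(Y.+1 <= p < N.+1 | prime p) (z p == k) = size s)%N.
  by rewrite size_filter -sum1_count big_mkcondr.
apply: size_primes_of_rank lu (u0 k k0) _ _; first by rewrite filter_uniq ?iota_uniq.
move=> p; rewrite mem_filter mem_index_iota => /andP[/andP[pp /eqP <-] /andP[Yp _]].
by have [_ _] := zP p pp Yp.
Qed.

(** * The estimate for the sum of the greatest common divisors *)

(** Here L stands for sqrt(l w). The bound on z costs only the factor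
(p z)^d <= p^(3 d) = exp(3 b w / 2). *)
Lemma smooth_count_large_prime (R : realType) (x b L : R) (N p z : nat) :
    let l := ln x in let w := ln l in
    1 <= l -> 0 < L -> L ^+ 2 = l * w -> 0 < w -> 2 * w <= L ->
    0 < b -> b <= 1 -> N%:R <= x -> p%:R <= x -> (1 < p)%N ->
    L / 2 <= ln p%:R -> (0 < z)%N -> (z <= p.+1)%N ->
  (smooth_count p (N %/ (p * z)))%:R <=
    x * expR (- (b * L)) * (Num.sqrt p%:R * z%:R)^-1 * expR (3 * (b * w / 2)) *
    expR (4 * (expR (b * w / 2) * (3 + 2 * ln (2 * l)))).
Proof.
move=> l w l1 L0 L2 w0 wL b0 b1 Nx px p1 Lp z0 zp.
have x0 : 0 < x by rewrite ltNge; apply/negP => /ln0 lx; move: l1; rewrite /l lx; lra.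
have pR : 0 < p%:R :> R by rewrite ltr0n ltnW.
have zR : 0 < z%:R :> R by rewrite ltr0n.
set lam := ln p%:R in Lp *.
have lam0 : 0 < lam by lra.
(* With this choice p^d = l^(b/2). *)
pose d := b * w / (2 * lam).
have dlam : d * lam = b * w / 2 by rewrite /d; field; rewrite gt_eqF.
have d0 : 0 <= d by rewrite /d divr_ge0 ?mulr_ge0 //; lra.
have d1 : d <= 1 / 2 by rewrite /d ler_pdivrMr; nra.
(* The mean inequality, at the cost of a factor sqrt p = exp(lam / 2). *)
have dl : b * L - lam / 2 <= d * l.
  have -> : d * l = b * L ^+ 2 / (2 * lam) by rewrite L2 /d; ring.
  rewrite ler_pdivlMr; last lra.
  have := sqr_ge0 (lam - b * L); have := sqr_ge0 L; nra.
have zlam : ln z%:R <= 2 * lam.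
  have -> : 2 * lam = ln (p%:R ^+ 2) by rewrite lnXn // mulr_natl.
  rewrite ler_ln ?posrE ?exprn_gt0 // -natrX ler_nat (leq_trans zp) //.
  rewrite -mulnn; apply: leq_trans (leq_mul p1 (leqnn p)).
  by rewrite mul2n -addnn -addn1 leq_add2l ltnW.
pose X := x / (p * z)%:R.
have pz0 : 0 < (p * z)%:R :> R by rewrite natrM mulr_gt0.
have X0 : 0 < X by rewrite divr_gt0.
have NX : (N %/ (p * z))%:R <= X.
  rewrite ler_pdivlMr // -natrM (le_trans _ Nx) // ler_nat.
  exact: leq_trunc_div.
apply: le_trans (smooth_count_le p NX X0 d0 d1) _.
have powE (y e : R) : 0 < y -> y `^ e = expR (e * ln y).
  by move=> y0; rewrite /powR gt_eqF.
have sqE : Num.sqrt p%:R = expR (lam / 2).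
  by rewrite -powR12_sqrt ?ler0n // powE // mulrC.
have -> : x * expR (- (b * L)) * (Num.sqrt p%:R * z%:R)^-1 * expR (3 * (b * w / 2)) =
    expR (l - b * L - lam / 2 - ln z%:R + 3 * (b * w / 2)).
  rewrite -[in LHS](@lnK _ x) // -[in LHS](@lnK _ z%:R) // sqE.
  by rewrite -!expRD -expRN -!expRD -/l; congr expR; ring.
apply: ler_pM; rewrite ?powR_ge0 ?expR_ge0 //.
  rewrite powE // ler_expR /X ln_div ?posrE // natrM lnM ?posrE // -/l -/lam.
  have : d * ln z%:R <= d * (2 * lam) by apply: ler_wpM2l.
  lra.
rewrite ler_expR ler_wpM2l // powE // -/lam dlam ler_wpM2l ?expR_ge0 //.
exact: sum_inv_primes_le.
Qed.

(** The same bound for the smoothness threshold Y <= exp(L / 2), where d is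
chosen so that exp(L / 2)^d = l^(b/2). *)
Lemma smooth_count_threshold (R : realType) (x b L : R) (N Y : nat) :
    let l := ln x in let w := ln l in
    1 <= l -> 0 < L -> L ^+ 2 = l * w -> 0 < w -> 2 * w <= L ->
    0 < b -> b <= 1 -> N%:R <= x -> Y%:R <= x -> Y%:R <= expR (L / 2) ->
  (smooth_count Y N)%:R <= x * expR (- (b * L)) *
    expR (4 * (expR (b * w / 2) * (3 + 2 * ln (2 * l)))).
Proof.
move=> l w l1 L0 L2 w0 wL b0 b1 Nx Yx YL.
have x0 : 0 < x by rewrite ltNge; apply/negP => /ln0 lx; move: l1; rewrite /l lx; lra.
pose d := b * w / L.
have dL : d * L = b * w by rewrite /d mulfVK // gt_eqF.
have d0 : 0 <= d by rewrite /d divr_ge0 ?mulr_ge0 //; lra.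
have d1 : d <= 1 / 2 by rewrite /d ler_pdivrMr; nra.
have dl : d * l = b * L.
  apply: (mulIf (lt0r_neq0 L0)); rewrite mulrAC dL -[RHS]mulrA -expr2 L2; ring.
apply: le_trans (smooth_count_le Y Nx x0 d0 d1) _.
have powE (y e : R) : 0 < y -> y `^ e = expR (e * ln y).
  by move=> y0; rewrite /powR gt_eqF.
have -> : x * expR (- (b * L)) = x `^ (1 - d).
  by rewrite powE // -/l mulrBl mul1r dl expRD lnK.
rewrite ler_wpM2l ?powR_ge0 // ler_expR ler_wpM2l // ler_pM ?powR_ge0 //.
- by rewrite sumr_ge0 // => p _; rewrite invr_ge0 ler0n.
- apply: (@le_trans _ _ (expR (L / 2) `^ d)).
    by apply: ge0_ler_powR; rewrite ?nnegrE ?ler0n ?expR_ge0.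
  by rewrite powE ?expR_gt0 // expRK mulrA dL.
- exact: sum_inv_primes_le.
Qed.

(** The ranks of all primes beyond |a2| + |disc|, which divide neither of these
two nonzero integers. *)
Lemma ranks_of_appearance (a1 a2 : int) (u : nat -> int) :
    is_lucas a1 a2 u -> lucas_disc a1 a2 != 0 ->
  exists z : nat -> nat, forall p, prime p ->
    (`|a2| + `|lucas_disc a1 a2| < p)%N ->
    [/\ (0 < z p)%N, (z p <= p.+1)%N, coprime p (z p)
      & forall n, (p %| `|u n|)%N = (z p %| n)%N].
Proof.
move=> lu D0; have [a20 _ _ _] := lu.
suff /choice[z zP] : forall p, exists zp, prime p ->
    (`|a2| + `|lucas_disc a1 a2| < p)%N ->
    [/\ (0 < zp)%N, (zp <= p.+1)%N, coprime p zp
      & forall n, (p %| `|u n|)%N = (zp %| n)%N] by exists z.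
move=> p.
have [[pp Dp]|npp] := pselect (prime p /\ (`|a2| + `|lucas_disc a1 a2| < p)%N);
  last by exists 0%N => pp Dp; case: npp.
have ndvd (m : int) : m != 0 -> (`|m| < p)%N -> ~~ (p %| `|m|)%N.
  move=> m0 mp; apply: contraL mp => /dvdn_leq; rewrite absz_gt0 m0 -leqNgt.
  exact.
have [||z zP] := @rank_of_appearance a1 a2 u p lu pp; last by exists z.
  by apply: ndvd => //; apply: leq_ltn_trans Dp; rewrite leq_addr.
by apply: ndvd => //; apply: leq_ltn_trans Dp; rewrite leq_addl.
Qed.

(** The sum of gcd(n, u_n) over the positive integers n <= x. *)
Definition gcd_sum (R : realType) (u : nat -> int) (x : R) : nat :=
  \sum_(1 <= n < (Num.truncn x).+1) gcdn n `|u n|.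

(** Markov's inequality. *)
Lemma large_gcd_count_le (R : realType) (u : nat -> int) (x y : R) :
  0 <= x -> 0 <= y -> (large_gcd_count u x y)%:R * y <= (gcd_sum u x)%:R.
Proof.
move=> x0 y0; rewrite /large_gcd_count; set A := fset_set _.
have inA n : n \in A -> [/\ (0 < n)%N, n%:R <= x & y < (gcdn n `|u n|)%:R].
  rewrite in_fset_set ?inE //; exact: finite_large_gcd_set.
pose g n : R := (gcdn n `|u n|)%:R.
have -> : #|` A|%:R * y = \sum_(n <- A) y.
  by rewrite big_const_seq count_predT iter_addr_0 mulr_natl.
apply: (@le_trans _ _ (\sum_(n <- A) g n)).
  by rewrite big_seq [leRHS]big_seq; apply: ler_sum => n /inA[_ _ /ltW].
rewrite /gcd_sum natr_sum.
have -> : \sum_(n <- A) g n =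
    \sum_(1 <= n < (Num.truncn x).+1 | n \in A) g n.
  rewrite -[RHS]big_filter; apply: perm_big; apply: uniq_perm => //.
    by rewrite filter_uniq ?iota_uniq.
  move=> n; rewrite mem_filter mem_index_iota ltnS.
  by apply/idP/andP => [nA|[] //]; have [-> nx _] := inA n nA; rewrite truncn_ge_nat.
by apply: ler_sum_subset => // n; rewrite ler0n.
Qed.

Lemma gcd_sum_le (R : realType) (a1 a2 : int) (u : nat -> int) (x b L : R) :
    is_lucas a1 a2 u -> lucas_nondegenerate R a1 a2 -> lucas_disc a1 a2 != 0 ->
    let l := ln x in let w := ln l in
    1 <= l -> 0 < L -> L ^+ 2 = l * w -> 0 < w -> 2 * w <= L ->
    0 < b -> b <= 1 -> (`|a2| + `|lucas_disc a1 a2|)%:R <= expR (L / 2) ->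
  (gcd_sum u x)%:R <= x ^+ 2 * expR (- (b * L)) *
    expR (4 * (expR (b * w / 2) * (3 + 2 * ln (2 * l)))) *
    (1 + expR (3 * (b * w / 2)) * ((1 + (`|a1| + `|a2|)%:R) * (2 + l))).
Proof.
move=> lu nd D0 l w l1 L0 L2 w0 wL b0 b1 DL.
have x0 : 0 < x by rewrite ltNge; apply/negP => /ln0 lx; move: l1; rewrite /l lx; lra.
have x1 : 1 <= x by rewrite -(@lnK _ x) // -expR0 ler_expR -/l; lra.
have wl : w <= l by apply/ltW/ln_sublinear; lra.
have Ll : L / 2 <= l.
  have : L ^+ 2 <= l ^+ 2 by rewrite L2 expr2 ler_wpM2l //; lra.
  by rewrite ler_pXn2r ?nnegrE //; lra.
have [z zP] := ranks_of_appearance lu D0.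
have u0 := lucas_neq0 lu nd D0.
pose N := Num.truncn x; pose Y := Num.truncn (expR (L / 2)).
have Nx : N%:R <= x by rewrite truncn_le; lra.
have YL : Y%:R <= expR (L / 2) by rewrite truncn_le ?expR_ge0.
have Yx : Y%:R <= x by rewrite (le_trans YL) // -[leRHS]lnK // ler_expR.
have DY : (`|a2| + `|lucas_disc a1 a2| <= Y)%N by rewrite truncn_ge_nat ?expR_ge0.
have zY p : prime p -> (Y < p)%N -> _ := fun pp Yp => zP p pp (leq_ltn_trans DY Yp).
have zY1 p : prime p -> (Y < p)%N -> [/\ (0 < z p)%N, coprime p (z p)
    & forall n, (p %| `|u n|)%N = (z p %| n)%N].
  by move=> pp Yp; have [] := zY p pp Yp.
have := sum_gcd_le_smooth N zY1; rewrite -(ler_nat R) => /le_trans; apply.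
set c := 1 + (`|a1| + `|a2|)%:R; set E3 := expR (3 * _).
set G := expR (4 * _); pose T := x * expR (- (b * L)).
have -> : x ^+ 2 * expR (- (b * L)) * G * (1 + E3 * (c * (2 + l))) =
  x * (T * G + T * G * E3 * (c * (2 + l))) by rewrite /T; ring.
rewrite natrM natrD natr_sum; apply: ler_pM => //.
  by rewrite addr_ge0 // sumr_ge0 // => p _; rewrite ler0n.
apply: lerD; first exact: smooth_count_threshold.
have zY' p : prime p -> (Y < p)%N ->
    [/\ (0 < z p)%N, (z p <= p.+1)%N & (p %| `|u (z p)|)%N].
  by move=> pp Yp; have [z0 zp _ zE] := zY p pp Yp; rewrite zE dvdnn.
have := sum_sqrt_rank_le lu u0 zY' x1 Nx; rewrite -/c -/l => Hsum.
have T0 : 0 <= T by rewrite mulr_ge0 ?expR_ge0 ?ltW.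
apply: (@le_trans _ _ (T * G * E3 *
  \sum_(Y.+1 <= p < N.+1 | prime p) (Num.sqrt p%:R * (z p)%:R)^-1)); last first.
  by apply: ler_wpM2l; [do 2!(apply: mulr_ge0; last exact: expR_ge0) | exact: Hsum].
rewrite big_distrr /= big_nat_cond [leRHS]big_nat_cond; apply: ler_sum => p.
move=> /andP[/andP[Yp pN] pp]; have [z0 zp _] := zY' p pp Yp.
apply: le_trans (smooth_count_large_prime l1 L0 L2 w0 wL b0 b1 Nx _ (prime_gt1 pp) _ z0 zp) _.
- by apply: le_trans Nx; rewrite ler_nat -ltnS.
- rewrite -ler_expR lnK ?posrE ?ltr0n ?prime_gt0 //.
  by rewrite ltW // -truncn_lt_nat ?expR_ge0.
by rewrite -/T -/E3 -/G; rewrite [leLHS](_ : _ = T * G * E3 * (Num.sqrt p%:R * (z p)%:R)^-1) //; ring.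
Qed.

(** For large x, the factors of the bound in [gcd_sum_le] other than x^2 and
exp(-b L) are together at most exp((1 - b) L). *)
Lemma gcd_sum_asymptotic (R : realType) (a1 a2 : int) (u : nat -> int) (b : R) :
    is_lucas a1 a2 u -> lucas_nondegenerate R a1 a2 -> lucas_disc a1 a2 != 0 ->
    0 < b -> b < 1 ->
  exists A : R, forall x, A <= x -> let L := Num.sqrt (ln x * ln (ln x)) in
    [/\ 1 <= x, 0 < L
      & (gcd_sum u x)%:R <= x ^+ 2 * expR (- ((2 * b - 1) * L))].
Proof.
move=> lu nd D0 b0 b1.
set c : R := 1 + (`|a1| + `|a2|)%:R.
set D : R := (`|a2| + `|lucas_disc a1 a2|)%:R.
have c1 : 1 <= c by rewrite lerDl ler0n.
have D0' : 0 <= D by rewrite ler0n.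
pose K := 35 + c.
have b1' : 0 < (1 - b) ^+ 3 by rewrite exprn_gt0 //; lra.
have q0 : 0 <= 8 * K / (1 - b) ^+ 3 by rewrite divr_ge0 ?ltW //; rewrite /K; lra.
(* The other factors are at most exp(K w exp(b w / 2)), and L >= exp(w / 2);
   the last term of w0 ensures that K w <= (1 - b) exp((1 - b) w / 2), through
   exp t >= t^2 / 2. *)
pose w0 := 16 + D + 8 * K / (1 - b) ^+ 3.
exists (expR (expR w0)) => x Ax L.
have x0 : 0 < x by apply: lt_le_trans Ax; exact: expR_gt0.
set l := ln x in L *; set w := ln l in L *.
have l_ge : expR w0 <= l by rewrite -ler_expR lnK.
have l0 : 0 < l by apply: lt_le_trans l_ge; exact: expR_gt0.
have lE : l = expR w by rewrite lnK.
have w_ge : w0 <= w by rewrite -ler_expR -lE.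
have w16 : 16 <= w by move: w_ge; rewrite /w0; lra.
have wD : D <= w by move: w_ge; rewrite /w0; lra.
have wK : K <= (1 - b) ^+ 3 * w / 8.
  have : 8 * K / (1 - b) ^+ 3 <= w by move: w_ge; rewrite /w0; lra.
  by rewrite ler_pdivrMr //; lra.
have l1 : 1 <= l by rewrite lE -expR0 ler_expR; lra.
have x1 : 1 <= x by rewrite -(lnK x0) -expR0 ler_expR -/l; lra.
have expR_sqr (t : R) : 0 <= t -> t ^+ 2 / 2 <= expR t.
  by move=> t0; have := expR_ge1Dxn 1 t0; rewrite (_ : 2`! = 2)%N //; lra.
have L2 : L ^+ 2 = l * w by rewrite sqr_sqrtr // mulr_ge0; lra.
have L_ge : expR (w / 2) <= L.
  rewrite -(@ler_pXn2r _ 2) ?nnegrE ?expR_ge0 ?sqrtr_ge0 // L2 -expRM_natl.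
  rewrite (_ : 2 * (w / 2) = w); last by lra.
  by rewrite -lE -[leLHS]mulr1 ler_wpM2l; lra.
have wL : 2 * w <= L.
  apply: le_trans L_ge; apply: le_trans (expR_sqr _ _); [nra | lra].
have L0 : 0 < L by lra.
have DL : D <= expR (L / 2).
  by apply: le_trans (expR_ge1Dx _); lra.
split=> //.
have := gcd_sum_le lu nd D0 l1 L0 L2 (_ : 0 < w) wL b0 (ltW b1) DL.
move=> /(_ _)/le_trans; apply; first by rewrite -/w; lra.
rewrite -/l -/w -/c.
set e := expR (b * w / 2).
have e1 : 1 <= e by rewrite -expR0 ler_expR; nra.
have G_le : expR (4 * (e * (3 + 2 * ln (2 * l)))) <= expR (28 * w * e).
  have ln2 : ln 2 <= 1 :> R by have := @le_ln1Dx R 1; rewrite (_ : 1 + 1 = 2) //; lra.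
  rewrite ler_expR lnM ?posrE // -/w.
  have : e * (3 + 2 * (ln 2 + w)) <= e * (7 * w) by apply: ler_wpM2l; lra.
  lra.
have F_le : 1 + expR (3 * (b * w / 2)) * (c * (2 + l)) <= expR (4 * w + c + 3).
  have bw : expR (3 * (b * w / 2)) <= expR (3 * w) by rewrite ler_expR; nra.
  have cl : c * (2 + l) <= expR (c + 2 + w).
    rewrite 2!expRD -lE; apply: (@le_trans _ _ (expR c * (3 * l))).
      apply: ler_pM; [lra | lra | | lra].
      by have := expR_ge1Dx c; lra.
    rewrite -mulrA; apply: ler_wpM2l; first exact: expR_ge0.
    apply: ler_wpM2r; first lra.
    by have := expR_ge1Dx (2 : R); lra.
  have H : expR (3 * (b * w / 2)) * (c * (2 + l)) <= expR (4 * w + c + 2).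
    rewrite (_ : 4 * w + c + 2 = 3 * w + (c + 2 + w)); last by lra.
    by rewrite expRD; apply: ler_pM; rewrite ?expR_ge0 // mulr_ge0; lra.
  have H1 : 1 <= expR (4 * w + c + 2) by rewrite -[leLHS]expR0 ler_expR; lra.
  rewrite (_ : 4 * w + c + 3 = 4 * w + c + 2 + 1); last by lra.
  rewrite expRD; have := expR_ge1Dx (1 : R).
  set z1 := expR 1; nra.
have main : 28 * w * e + (4 * w + c + 3) <= (1 - b) * L.
  have K_le : 28 * w * e + (4 * w + c + 3) <= K * w * e.
    have : w * 1 <= w * e by apply: ler_wpM2l; lra.
    rewrite /K; nra.
  apply: le_trans K_le _; apply: (@le_trans _ _ ((1 - b) * expR (w / 2))).
    rewrite (_ : w / 2 = (1 - b) * w / 2 + b * w / 2); last by lra.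
    rewrite expRD mulrA -/e; apply: ler_wpM2r; first lra.
    have t0 : 0 <= (1 - b) * w / 2 by nra.
    apply: le_trans (ler_wpM2l _ (expR_sqr _ t0)); last lra.
    apply: le_trans (ler_wpM2r _ wK) _; first lra.
    by rewrite le_eqVlt; apply/orP; left; apply/eqP; by field.
  by apply: ler_wpM2l; lra.
set G := expR (4 * _) in G_le *; set F := 1 + _ in F_le *.
rewrite -2!mulrA; apply: (ler_wpM2l (sqr_ge0 x)).
apply: (@le_trans _ _ (expR (- (b * L)) * (expR (28 * w * e) * expR (4 * w + c + 3)))).
  apply: ler_wpM2l; first exact: expR_ge0.
  apply: ler_pM => //; first exact: expR_ge0.
  by rewrite /F addr_ge0 // mulr_ge0 ?expR_ge0 // mulr_ge0; lra.
by rewrite -!expRD ler_expR; lra.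
Qed.

(** * The count of large greatest common divisors *)

Theorem corollary1p5 (R : realType) (a1 a2 : int) (u : nat -> int)
    (lucas_u : is_lucas a1 a2 u)
    (nondeg_u : lucas_nondegenerate R a1 a2)
    (disc_u : lucas_disc a1 a2 != 0) :
  exists2 eps : R -> R, eps t @[t --> +oo] --> (0 : R) &
    \forall x \near +oo, forall y : R, 1 <= y ->
      (large_gcd_count u x y)%:R <=
        x ^+ 2 / (y * expR ((1 + eps x) * Num.sqrt (ln x * ln (ln x)))) :> R.
Proof.
pose L (x : R) := Num.sqrt (ln x * ln (ln x)).
pose S (x : R) : R := (gcd_sum u x)%:R.
have S0 x : 1 <= x -> 0 < S x.
  move=> x1; rewrite ltr0n /gcd_sum; have := x1; rewrite -truncn_gt0.
  case: (Num.truncn x) => // n _.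
  by rewrite big_ltn // addn_gt0 gcdn_gt0.
(* With the second argument of min as eps x, the number S x would equal
   x^2 exp(-(1 + eps x) L x); capping at 0 spares a lower bound for S. *)
pose eps (x : R) := Num.min 0 (- ln (S x / x ^+ 2) / L x - 1).
exists eps.
  apply/cvgrPdist_le => /= e e0.
  pose e' : R := Num.min e 1.
  have e'0 : 0 < e' by rewrite lt_min e0 ltr01.
  have e'1 : e' <= 1 by rewrite ge_min lexx orbT.
  have b0 : 0 < 1 - e' / 2 by lra.
  have b1 : 1 - e' / 2 < 1 by lra.
  have [A HA] := gcd_sum_asymptotic lucas_u nondeg_u disc_u b0 b1.
  apply: filterS (nbhs_pinfty_ge (num_real A)) => x /HA[x1 L0 SA].
  have x2 : 0 < x ^+ 2 by rewrite exprn_gt0; lra.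
  rewrite sub0r normrN ler0_norm; last by rewrite ge_min lexx.
  apply: (@le_trans _ _ e'); last by rewrite ge_min lexx.
  rewrite lerNl le_min; apply/andP; split; first lra.
  rewrite lerBrDr ler_pdivlMr // lerNr -ler_expR lnK ?posrE ?divr_gt0 ?S0 //.
  rewrite ler_pdivrMr // mulrC; apply: le_trans SA _.
  apply: ler_wpM2l; first exact: ltW.
  rewrite ler_expR -/(L x) le_eqVlt; apply/orP; left; apply/eqP; by field.
have half0 : 0 < 1 / 2 :> R by lra.
have half1 : 1 / 2 < 1 :> R by lra.
have [B HB] := gcd_sum_asymptotic lucas_u nondeg_u disc_u half0 half1.
apply: filterS (nbhs_pinfty_ge (num_real B)) => x /HB[x1 L0 _] y y1.
have x2 : 0 < x ^+ 2 by rewrite exprn_gt0; lra.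
have y0 : 0 < y by lra.
rewrite ler_pdivlMr ?mulr_gt0 ?expR_gt0 // mulrA.
apply: (@le_trans _ _ (S x * expR ((1 + eps x) * L x))).
  by apply: ler_wpM2r; [exact: expR_ge0 | apply: large_gcd_count_le; lra].
rewrite -ler_pdivlMr ?expR_gt0 // mulrC -expRN -ler_pdivrMr //.
rewrite -[leLHS](@lnK _ (S x / x ^+ 2)) ?posrE ?divr_gt0 ?S0 // ler_expR.
rewrite lerNr -ler_pdivlMr // -lerBrDl.
by rewrite ge_min lexx orbT.
Qed.
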